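(* Let $\mathbb{F}$ be a field, $d$ a positive integer, and let $(\mathcal J,\mathcal L)$ be a joints configuration in $\mathbb{F}^d$. If $J\coloneqq|\mathcal J|=\binom{x}{d}$ for some real number $x\geq d$, then $L\coloneqq|\mathcal L|\geq \binom{x}{d-1}$.
   Context: A point $p\in\mathbb{F}^d$ is a joint of a set of lines $\mathcal L$ if $p$ lies on $d$ lines of $\mathcal L$ whose directions are linearly independent. A joints configuration $(\mathcal J,\mathcal L)$ consists of a finite set $\mathcal L$ of lines in $\mathbb{F}^d$ and a finite set $\mathcal J$ of points each of which is a joint of $\mathcal L$. For real $x$ and a nonnegative integer $k$, $\binom{x}{k}=x(x-1)\cdots(x-k+1)/k!$. *)

(* Defs.v *)
From HB Require Import structures.
From mathcomp Require Import all_boot all_order all_algebra.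
From mathcomp Require Import finmap.
From mathcomp Require Import boolp classical_sets reals.

Set Implicit Arguments.
Unset Strict Implicit.
Unset Printing Implicit Defensive.

Import Order.TTheory GRing.Theory Num.Theory.

Local Open Scope classical_set_scope.
Local Open Scope ring_scope.

Section Joints.
Variables (F : fieldType) (d : nat).

Definition line_through (p v : 'rV[F]_d) : set 'rV[F]_d :=
  [set q | exists t : F, q = p + t *: v].

(* A line determines its direction only up to a nonzero scalar, so "v is a
   direction of l" is a relation. *)
Definition is_direction (l : set 'rV[F]_d) (v : 'rV[F]_d) : Prop :=
  v != 0 /\ exists p, l = line_through p v.

Definition is_line (l : set 'rV[F]_d) : Prop := exists v, is_direction l v.

(* The d lines are automatically distinct, since parallel lines have dependent
   directions. *)
Definition is_joint (L : {fset set 'rV[F]_d}) (p : 'rV[F]_d) : Prop :=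
  exists (l : 'I_d -> set 'rV[F]_d) (v : 'I_d -> 'rV[F]_d),
    (forall i, [/\ l i \in L, l i p & is_direction (l i) (v i)]) /\
    free [tuple v i | i < d].

Definition joints_configuration
    (J : {fset 'rV[F]_d}) (L : {fset set 'rV[F]_d}) : Prop :=
  (forall l, l \in L -> is_line l) /\ (forall p, p \in J -> is_joint L p).

End Joints.

Definition gbinom (R : realType) (x : R) (k : nat) : R :=
  (\prod_(i < k) (x - i%:R)) / (k`!)%:R.

(* Main.v *)
(* Handicap the joints by integers [D p] and kill, at each joint [p], the coefficients
   of the Taylor expansion along its [d] lines whose exponents [g] satisfy, for all
   [i],  [sum_(q on line i, q <> p) (g_i + D p - D q)^+ + |g| <= n].  A polynomial of
   degree at most [n] with all these coefficients zero vanishes: at a surviving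
   coefficient of minimal [|g| + D p], fix the exponents other than [g_i], where [i]
   violates the inequality; the remaining polynomial in one variable has too many
   zeros on line [i]. So these regions have at least [C(n+d, d)] points in total, and
   the handicaps can be chosen so that each of the [J] regions has about the average
   [n^d / (d! J)].

   Dropping the positive parts, with [k_i] joints on line [i], the region of [p] lies in
   [k_i g_i + sum_(j <> i) g_j <= r_i], and the [r_i] average to [n] because the
   handicaps cancel on each line. By the multiplicative Brunn-Minkowski (Prekopa)
   inequality, applied to all the regions and their cyclic shifts, the region with
   all [r_i = n] and all [k_i = k], the geometric mean of the numbers of joints, has
   volume at least [n^d / (d! J)]. That volume is [n^d / (k (k+1) ... (k+d-1))], so
   [k (k+1) ... (k+d-1) <= d! J = x (x-1) ... (x-d+1)] and [k <= x-d+1]. Finally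
   [L >= sum 1/k_i >= d J / k]. *)
Require Import Defs.
From HB Require Import structures.
From mathcomp Require Import all_boot all_order all_algebra.
From mathcomp Require Import finmap.
From mathcomp Require Import boolp classical_sets reals.
From mathcomp Require Import mpoly zify ring lra.

Set Implicit Arguments.
Unset Strict Implicit.
Unset Printing Implicit Defensive.

Import Order.TTheory GRing.Theory Num.Theory.

Local Open Scope fset_scope.
Local Open Scope ring_scope.

(** * Geometric means and the multiplicative Brunn-Minkowski inequality *)

Section GeometricMean.
Variables (R : rcfType) (I : finType).
Implicit Types F G : I -> R.

(** The hypotheses stand under the existential so that [cid] gives a total function. The root comes
    from the intermediate value theorem on [[0, 1 + x]]. *)
Lemma nroot_exists (n : nat) (x : R) :
  exists y : R, (0 < n)%N -> 0 <= x -> 0 <= y /\ y ^+ n = x.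
Proof.
case: (posnP n) => [->|n0]; first by exists 0.
have [x0|xn0] := boolP (0 <= x); last by exists 0.
have le0 : 0 <= 1 + x by lra.
have sgn : ('X^n - x%:P).[0] <= 0 <= ('X^n - x%:P).[1 + x].
  rewrite !hornerE expr0n eqn0Ngt n0 /= sub0r oppr_le0 x0 subr_ge0.
  by apply: (@le_trans _ _ (1 + x)); [lra | apply: ler_eXnr; [lia|lra]].
have [y /andP[y0 _] /rootP] := poly_ivt le0 sgn.
rewrite !hornerE => /eqP; rewrite subr_eq0 => /eqP yx.
by exists y.
Qed.

Definition nroot n x : R := projT1 (cid (nroot_exists n x)).

Definition gmean F : R := nroot #|I| (\prod_i F i).

Hypothesis I_gt0 : (0 < #|I|)%N.

Lemma gmean_spec F : (forall i, 0 <= F i) ->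
  0 <= gmean F /\ gmean F ^+ #|I| = \prod_i F i.
Proof.
move=> F0; rewrite /gmean /nroot; case: cid => y /= yP; apply: yP => //.
exact: prodr_ge0.
Qed.

Lemma gmean_ge0 F : (forall i, 0 <= F i) -> 0 <= gmean F.
Proof. by case/gmean_spec. Qed.

Lemma gmeanX F : (forall i, 0 <= F i) -> gmean F ^+ #|I| = \prod_i F i.
Proof. by case/gmean_spec. Qed.

Lemma le_gmean F G : (forall i, 0 <= F i <= G i) -> gmean F <= gmean G.
Proof.
move=> FG; have F0 i : 0 <= F i by case/andP: (FG i).
have G0 i : 0 <= G i by case/andP: (FG i) => /le_trans; apply.
rewrite -(@ler_pXn2r _ #|I|) ?nnegrE ?gmean_ge0 // !gmeanX //.
exact: ler_prod.
Qed.

Lemma gmean_unique F y : (forall i, 0 <= F i) -> 0 <= y ->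
  y ^+ #|I| = \prod_i F i -> y = gmean F.
Proof.
move=> F0 y0 yF; apply: (@pexpIrn _ #|I|) => //; rewrite ?nnegrE ?gmean_ge0 //.
by rewrite gmeanX.
Qed.

Lemma gmeanM F G : (forall i, 0 <= F i) -> (forall i, 0 <= G i) ->
  gmean (fun i => F i * G i) = gmean F * gmean G.
Proof.
move=> F0 G0; apply/esym/gmean_unique => [i||].
- exact: mulr_ge0.
- by rewrite mulr_ge0 ?gmean_ge0.
- by rewrite exprMn !gmeanX // big_split.
Qed.

Lemma gmean_cst c : 0 <= c -> gmean (fun=> c) = c.
Proof. by move=> c0; apply/esym/gmean_unique => //; rewrite prodr_const. Qed.

Lemma gmean_le_mean F : (forall i, 0 <= F i) -> gmean F <= (\sum_i F i) / #|I|%:R.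
Proof.
move=> F0; have m0 : 0 <= (\sum_i F i) / #|I|%:R.
  by rewrite divr_ge0 ?ler0n ?sumr_ge0.
rewrite -(@ler_pXn2r _ #|I|) ?nnegrE ?gmean_ge0 // gmeanX //.
exact: (leif_AGM (A := predT) (fun i _ => F0 i)).1.
Qed.

Lemma gmean_eq0 F i : (forall i, 0 <= F i) -> F i = 0 -> gmean F = 0.
Proof.
move=> F0 Fi0; apply/esym/gmean_unique => //.
by rewrite (bigD1 i) //= Fi0 mul0r expr0n eqn0Ngt I_gt0.
Qed.

(** After division by [H = F + G], the arithmetic-geometric mean inequality bounds the two ratios by
    means that add up to 1. If [H] has a zero, both geometric means on the left vanish. *)
Lemma gmeanD F G : (forall i, 0 <= F i) -> (forall i, 0 <= G i) ->
  gmean F + gmean G <= gmean (fun i => F i + G i).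
Proof.
move=> F0 G0; set H := fun i => F i + G i.
have H0 i : 0 <= H i by rewrite /H addr_ge0.
have [/existsP[i /eqP Hi]|/existsPn Hn] := boolP [exists i, H i == 0].
  move: Hi => /eqP; rewrite /H paddr_eq0 // => /andP[/eqP Fi /eqP Gi].
  by rewrite (gmean_eq0 F0 Fi) (gmean_eq0 G0 Gi) addr0 gmean_ge0.
have quo K : (forall i, 0 <= K i) -> gmean K <=
    gmean H * ((\sum_i K i / H i) / #|I|%:R).
  move=> K0; have KH0 i : 0 <= K i / H i by rewrite divr_ge0.
  rewrite (_ : gmean K = gmean H * gmean (fun i => K i / H i)).
    by rewrite ler_wpM2l ?gmean_ge0 // gmean_le_mean.
  rewrite -gmeanM //; congr gmean; apply/funext => i.
  by rewrite mulrC mulfVK.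
apply: le_trans (lerD (quo F F0) (quo G G0)) _.
rewrite -mulrDr -mulrDl -big_split /= (eq_bigr (fun=> 1)) => [|i _].
  by rewrite sumr_const divff ?mulr1 // pnatr_eq0 -lt0n.
by rewrite -mulrDl divff //; apply: Hn.
Qed.

Lemma gmean_sum (J : finType) (F : J -> I -> R) : (forall j i, 0 <= F j i) ->
  \sum_j gmean (F j) <= gmean (fun i => \sum_j F j i).
Proof.
move=> F0; elim: (index_enum J) => [|j s IH].
  by rewrite big_nil gmean_ge0 // => i; rewrite big_nil.
rewrite big_cons; apply: le_trans (lerD (lexx _) IH) _.
have -> : (fun i => \sum_(j0 <- j :: s) F j0 i) =
    (fun i => F j i + \sum_(j0 <- s) F j0 i).
  by apply/funext => i; rewrite big_cons.
by apply: gmeanD => // i; apply: sumr_ge0.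
Qed.

End GeometricMean.

(** * One-dimensional mass transport for geometric means *)

Section UnitClamp.
Variable R : realDomainType.

(** The length of the part of [[0, X]] inside [[a, a + 1]]. *)
Definition clamp (a : nat) (X : R) := Num.min (Num.max (X - a%:R) 0) 1.

Lemma clamp_ge0 a X : 0 <= clamp a X.
Proof. by rewrite /clamp le_min ler01 le_max lexx orbT. Qed.

Lemma clamp_le1 a X : clamp a X <= 1.
Proof. by rewrite /clamp ge_min lexx orbT. Qed.

Lemma le_clamp a X Y : X <= Y -> clamp a X <= clamp a Y.
Proof.
move=> XY; rewrite /clamp le_min ge_min ge_max !le_max lerD2r XY lexx orbT /=.
by rewrite ge_min lexx orbT.
Qed.

Lemma clamp_eq0 a X : X <= a%:R -> clamp a X = 0.
Proof.
move=> Xa; rewrite /clamp max_r; last by rewrite subr_le0.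
by rewrite min_l ?ler01.
Qed.

Lemma sum_clamp M X : 0 <= X <= M%:R -> \sum_(a < M) clamp a X = X.
Proof.
elim: M X => [|M IH] X; first by rewrite -eq_le => /eqP <-; rewrite big_ord0.
rewrite -natr1 => /andP[X0 XM]; rewrite big_ord_recr /=.
have [XM'|/ltW MX] := leP X M%:R.
  by rewrite IH ?X0 // clamp_eq0 // addr0.
rewrite (eq_bigr (fun i : 'I_M => clamp i (M%:R))) => [|i _].
  rewrite IH ?ler0n ?lexx // /clamp max_l ?min_l; lra.
have iM : (i : nat)%:R + 1 <= M%:R :> R by rewrite natr1 ler_nat.
by rewrite /clamp !max_l ?min_r //; lra.
Qed.

End UnitClamp.

Section Listing.
Variable R : realFieldType.
Variable c : nat -> nat.

(** The histogram [c] is cut into pieces of area 1: column [t] has [c t] pieces, each of height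
    [c t] and width [1 / c t]. *)
Definition listing M := flatten [seq nseq (c t) t | t <- iota 0 M].

Lemma listingS M : listing M.+1 = listing M ++ nseq (c M) M.
Proof. by rewrite /listing -addn1 iotaD map_cat flatten_cat /= cats0. Qed.

Lemma size_listing M : size (listing M) = (\sum_(t < M) c t)%N.
Proof.
elim: M => [|M IH]; first by rewrite big_ord0.
by rewrite listingS size_cat IH size_nseq big_ord_recr.
Qed.

Lemma mem_listing M t : (t \in listing M) -> (t < M)%N /\ (0 < c t)%N.
Proof.
by case/flatten_mapP => i; rewrite mem_iota /= mem_nseq => ? /andP[? /eqP ->].
Qed.

Lemma sum_nseq_listing (j t : nat) : (j <= c t)%N ->
  \sum_(x <- nseq j t) (c x)%:R^-1 <= 1 :> R.
Proof.
move=> jc; have -> : \sum_(x <- nseq j t) (c x)%:R^-1 = j%:R / (c t)%:R :> R.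
  by rewrite big_nseq iter_addr_0 mulr_natl.
have [c0|c0] := posnP (c t).
  by move: jc; rewrite c0 leqn0 => /eqP ->; rewrite mul0r ler01.
by rewrite ler_pdivrMr ?ltr0n // mul1r ler_nat.
Qed.

Lemma sum_listing M : \sum_(x <- listing M) (c x)%:R^-1 <= M%:R :> R.
Proof.
elim: M => [|M IH]; first by rewrite big_nil.
by rewrite listingS big_cat /= -natr1 lerD // sum_nseq_listing.
Qed.

(** A column has total width 1, or 0 if it is empty, so the pieces up to one in column [t] end at
    [t + 1] or earlier. *)
Lemma sum_take_listing M b : (b < size (listing M))%N ->
  \sum_(x <- take b.+1 (listing M)) (c x)%:R^-1 <= (nth 0%N (listing M) b).+1%:R :> R.
Proof.
elim: M => [|M IH] //; rewrite listingS size_cat size_nseq => bs.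
rewrite nth_cat; case: ifP => bM; first by rewrite takel_cat ?IH.
move/negbT: bM; rewrite -leqNgt => bM.
rewrite take_cat ltnNge (leqW bM) /= big_cat /= nth_nseq.
have -> : (b - size (listing M) < c M)%N by lia.
rewrite take_nseq; last by lia.
by rewrite -natr1 lerD // ?sum_listing // sum_nseq_listing //; lia.
Qed.

End Listing.

Section Transport.
Variables (R : rcfType) (I : finType).
Hypothesis I_gt0 : (0 < #|I|)%N.

(** A discrete Prekopa-Leindler inequality, by transport: all histograms are cut into equally many
    pieces, and the [b]-th pieces are matched. *)
Lemma gmean_transport (f : I -> nat -> nat) (h : nat -> R) (M : nat) :
  (forall a, 0 <= h a) ->
  (forall (t : I -> nat) (a : nat), (forall i, (t i < M)%N) ->
     a%:R < gmean (fun i => (t i).+1%:R : R) ->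
     gmean (fun i => (f i (t i))%:R : R) <= h a) ->
  gmean (fun i => (\sum_(t < M) f i t)%:R : R) <= \sum_(a < M) h a.
Proof.
move=> h0 fh; have /card_gt0P[i0 _] := I_gt0; pose F i := (\sum_(t < M) f i t)%N.
have h_ge0 : 0 <= \sum_(a < M) h a by apply: sumr_ge0.
have [/existsP[i /eqP Fi]|/existsPn Fn] := boolP [exists i, F i == 0%N].
  by rewrite (gmean_eq0 I_gt0 (i := i)) //; rewrite -/(F i) Fi.
(* The weights [mi i] give every histogram the same mass [m], hence the same number of pieces. *)
pose m := (\prod_i F i)%N; pose mi i := (m %/ F i)%N.
have F_gt0 i : (0 < F i)%N by rewrite lt0n.
have miF i : (mi i * F i)%N = m.
  by rewrite /mi divnK // /m (bigD1 i) //= dvdn_mulr.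
have m_gt0 : (0 < m)%N by rewrite prodn_gt0.
have mi_gt0 i : (0 < mi i)%N by have := miF i; case: (mi i) => //; lia.
pose c i t := (mi i * f i t)%N; pose s i := listing (c i) M.
have size_s i : size (s i) = m.
  by rewrite size_listing -(miF i) /F big_distrr.
pose t i b := nth 0%N (s i) b.
have tP i b : (b < m)%N -> (t i b < M)%N /\ (0 < c i (t i b))%N.
  by move=> bm; apply: mem_listing; rewrite mem_nth // size_s.
pose T i b : R := \sum_(x <- take b (s i)) (c i x)%:R^-1.
have T_ge0 i b : 0 <= T i b.
  by apply: sumr_ge0 => x _; rewrite invr_ge0 ler0n.
have T0 i : T i 0%N = 0 by rewrite /T take0 big_nil.
have TS i b : (b < m)%N -> T i b.+1 = T i b + (c i (t i b))%:R^-1.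
  by move=> bm; rewrite /T (take_nth 0%N) ?size_s // -cats1 big_cat big_seq1.
have T_le i b : (b < m)%N -> T i b.+1 <= (t i b).+1%:R.
  by move=> bm; apply: sum_take_listing; rewrite -/(s i) size_s.
(* The matched pieces end at the geometric mean [gT] of their ends; by superadditivity it advances
   by at least the geometric mean [D] of their widths. *)
pose gT b := gmean (T ^~ b).
pose D b := gmean (fun i => (c i (t i b))%:R^-1 : R).
pose G b := gmean (fun i => (f i (t i b))%:R : R).
have gTS b : (b < m)%N -> gT b + D b <= gT b.+1.
  move=> bm; apply: le_trans (gmeanD _ _ _) _ => // [i|].
    by rewrite invr_ge0 ler0n.
  apply: le_gmean => // i; rewrite TS // lexx andbT addr_ge0 //.
  by rewrite invr_ge0 ler0n.
have D_ge0 b : 0 <= D b by apply: gmean_ge0 => // i; rewrite invr_ge0 ler0n.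
have G_ge0 b : 0 <= G b by apply: gmean_ge0.
have gT_ge0 b : 0 <= gT b by apply: gmean_ge0.
have gT_le b : (b <= m)%N -> gT b <= M%:R.
  case: b => [_|b bm]; first by rewrite /gT (gmean_eq0 I_gt0 _ (T0 i0)).
  apply: le_trans (_ : gmean (fun _ : I => M%:R : R) <= _); last by rewrite gmean_cst.
  apply: le_gmean => // i; rewrite T_ge0 /= (le_trans (T_le i b bm)) // ler_nat.
  by have [] := tP i b bm.
(* Each product [D b * G b] is the geometric mean of the [1 / mi i], independently of [b]. *)
have gFE : gmean (fun i => (F i)%:R : R) = \sum_(b < m) D b * G b.
  rewrite (eq_bigr (fun=> gmean (fun i => (mi i)%:R^-1 : R))) => [|b _].
    rewrite sumr_const card_ord -mulr_natl -[m%:R](gmean_cst I_gt0) //.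
    rewrite -gmeanM // => [|i]; last by rewrite invr_ge0.
    congr gmean; apply/funext => i.
    by rewrite -(miF i) natrM mulrC mulKf // pnatr_eq0 -lt0n.
  rewrite -gmeanM // => [|i]; last by rewrite invr_ge0.
  congr gmean; apply/funext => i.
  have [_] := tP i b (ltn_ord b); rewrite /c muln_gt0 => /andP[_ f0].
  by rewrite natrM invfM mulfVK // pnatr_eq0 -lt0n.
rewrite -/F gFE.
(* The advance of [gT] is split among the cells [[a, a + 1]]. A cell that it reaches has
   [a < gT b.+1], so [fh] bounds [G b] by [h a] there. *)
apply: (@le_trans _ _ (\sum_(b < m) \sum_(a < M)
    (clamp a (gT b.+1) - clamp a (gT b)) * h a)).
  apply: ler_sum => b _; have bm := ltn_ord b.
  apply: (@le_trans _ _ ((gT b.+1 - gT b) * G b)).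
    by rewrite ler_wpM2r // lerBrDl gTS.
  rewrite -[X in (X - _) * _](@sum_clamp _ M) ?gT_ge0 ?gT_le //.
  rewrite -[X in (_ - X) * _](@sum_clamp _ M) ?gT_ge0 ?gT_le // 1?ltnW //.
  rewrite -sumrB mulr_suml; apply: ler_sum => a _.
  have cl : 0 <= clamp a (gT b.+1) - clamp a (gT b).
    by rewrite subr_ge0 le_clamp // (le_trans _ (gTS _ bm)) // lerDl.
  have [aT|Ta] := ltP a%:R (gT b.+1).
    rewrite ler_wpM2l //; apply: fh => [i|]; first by have [] := tP i b bm.
    apply: lt_le_trans aT _; apply: le_gmean => // i.
    by rewrite T_ge0 T_le.
  have gTb : gT b <= a%:R.
    by apply: le_trans Ta; apply: le_trans (gTS b bm); rewrite lerDl.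
  by rewrite !clamp_eq0 // subrr !mul0r.
(* Over all [b], a cell receives at most its length 1. *)
rewrite exchange_big /=; apply: ler_sum => a _.
rewrite -mulr_suml -{2}[h a]mul1r ler_wpM2r //.
rewrite -(big_mkord xpredT (fun b => clamp a (gT b.+1) - clamp a (gT b))).
rewrite telescope_sumr //; have := clamp_le1 a (gT m).
have := clamp_ge0 a (gT 0%N); lra.
Qed.

End Transport.

(** * Brunn-Minkowski in every dimension, by slicing *)

Section TupleSlices.
Variables (d M : nat).
Implicit Type A : {set d.+1.-tuple 'I_M}.

(** The index is a natural number to fit [gmean_transport]; slices with [t >= M] are empty. *)
Definition slice A (t : nat) : {set d.-tuple 'I_M} :=
  [set u : d.-tuple 'I_M | [exists x : 'I_M, (x == t :> nat) && ([tuple of x :: u] \in A)]].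

Lemma in_slice A (x : 'I_M) (u : d.-tuple 'I_M) :
  (u \in slice A x) = ([tuple of x :: u] \in A).
Proof.
rewrite inE; apply/existsP/idP => [[y /andP[/eqP/val_inj -> //]]|uA].
by exists x; rewrite eqxx.
Qed.

Lemma card_slices A : #|A| = (\sum_(t < M) #|slice A t|)%N.
Proof.
have -> : #|A| = (\sum_(v in A) 1)%N by rewrite sum1_card.
rewrite (eq_bigr (fun t : 'I_M => \sum_(u in slice A t) 1)%N) => [|t _]; last first.
  by rewrite sum1_card.
pose g (p : 'I_M * d.-tuple 'I_M) : d.+1.-tuple 'I_M := [tuple of p.1 :: p.2].
pose g' (v : d.+1.-tuple 'I_M) := (thead v, [tuple of behead v]).
rewrite pair_big_dep /= (reindex g) /=; last first.
  exists g' => [[x u] _|v _]; last by rewrite /g /g' [RHS]tuple_eta; apply: val_inj.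
  by rewrite /g' /g /= theadE; congr pair; apply: val_inj.
by apply: eq_bigl => -[x u]; rewrite /= in_slice.
Qed.

End TupleSlices.

Section MultiplicativeBrunnMinkowski.
Variables (R : rcfType) (I : finType).
Hypothesis I_gt0 : (0 < #|I|)%N.

(** Points stand for unit cubes: [a] is kept when its lower corner lies strictly below the geometric
    mean of the upper corners of chosen cubes. *)
Definition gmean_set d M (A : I -> {set d.-tuple 'I_M}) : {set d.-tuple 'I_M} :=
  [set a : d.-tuple 'I_M | [exists t : {ffun I -> d.-tuple 'I_M}, [forall i, t i \in A i] &&
    [forall l, (tnth a l)%:R < gmean (fun i => (tnth (t i) l).+1%:R : R)]]].

(** Induction on [d]: the transport inequality is applied to the sizes of the slices. Its hypothesis
    is the inductive claim, since [gmean_set] of slices lies in a slice of [gmean_set]. *)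
Lemma gmean_card_le d M (A : I -> {set d.-tuple 'I_M}) :
  gmean (fun i => #|A i|%:R : R) <= #|gmean_set A|%:R.
Proof.
elim: d A => [|d IH] A.
  have [/existsP[i /eqP Ai]|/existsPn An] := boolP [exists i, A i == finset.set0].
    by rewrite (gmean_eq0 I_gt0 (i := i)) ?ler0n // Ai cards0.
  have At i : [tuple] \in A i.
    by have /set0Pn[u] := An i; rewrite (tuple0 u).
  have A1 i : A i = [set [tuple]].
    by apply/setP => u; rewrite (tuple0 u) At inE eqxx.
  rewrite [X in gmean X](_ : _ = fun=> 1) ?gmean_cst //; last first.
    by apply/funext => i; rewrite A1 cards1.
  rewrite ler1n card_gt0; apply/set0Pn; exists [tuple]; rewrite inE.
  apply/existsP; exists [ffun=> [tuple]]; apply/andP; split; apply/forallP => i.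
    by rewrite ffunE.
  by case: i.
rewrite [X in gmean X](_ : _ = fun i => (\sum_(t < M) #|slice (A i) t|)%:R); last first.
  by apply/funext => i; rewrite card_slices.
rewrite card_slices natr_sum.
apply: (gmean_transport I_gt0 (f := fun i t => #|slice (A i) t|)
  (h := fun t => #|slice (gmean_set A) t|%:R)) => // t a tM at_lt.
have aM : (a < M)%N.
  rewrite -(ltr_nat R); apply: lt_le_trans at_lt _.
  rewrite -(gmean_cst I_gt0 (ler0n R M)); apply: le_gmean => // i.
  by rewrite ler0n ler_nat tM.
apply: le_trans (IH _) _; rewrite ler_nat; apply/subset_leq_card/fintype.subsetP => u.
rewrite inE => /existsP[v /andP[/forallP vA /forallP uv]].
rewrite -[a]/(val (Ordinal aM)) in_slice inE; apply/existsP.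
exists [ffun i => [tuple of Ordinal (tM i) :: v i]]; apply/andP; split.
  by apply/forallP => i; rewrite ffunE -in_slice.
apply/forallP => l; case: (unliftP ord0 l) => [l'|] ->.
  rewrite tnthS (_ : (fun i => _) = fun i => (tnth (v i) l').+1%:R); first exact: uv.
  by apply/funext => i; rewrite ffunE tnthS.
rewrite tnth0 (_ : (fun i => _) = fun i => (t i).+1%:R) //.
by apply/funext => i; rewrite ffunE tnth0.
Qed.

End MultiplicativeBrunnMinkowski.

(** * Counting the points of the symmetric region *)

Section CountBound.
Variables (R : realFieldType) (k : R) (m : nat).
Hypothesis k_ge1 : 1 <= k.

(** The constraints are [k a_i + sum_(l != i) a_l <= X]. *)
Definition corner d (X : R) : {set d.-tuple 'I_m.+1} :=
  [set a : d.-tuple 'I_m.+1 |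
    [forall i, (k - 1) * (tnth a i)%:R + (\sum_l tnth a l)%N%:R <= X]].

Definition insert_above d (b : 'I_m.+1) (i : 'I_d.+1) (u : d.-tuple 'I_m.+1) :
    d.+1.-tuple 'I_m.+1 :=
  [tuple if unlift i l is Some j then inord (tnth u j + b) else b | l < d.+1].

(** A least coordinate [b], at position [i], is removed and subtracted from the others. The sum
    drops by [(d + 1) b], so each constraint loses [(k - 1) b + (d + 1) b = (k + d) b]. *)
Lemma corner_insert d (X : R) (a : d.+1.-tuple 'I_m.+1) : a \in corner d.+1 X ->
  exists (b : 'I_m.+1) (i : 'I_d.+1) (u : d.-tuple 'I_m.+1),
    [/\ a = insert_above b i u, (k + d%:R) * b%:R <= X &
        u \in corner d (X - (k + d%:R) * b%:R)].
Proof.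
rewrite inE => /forallP aX.
pose i := [arg min_(j < ord0) (tnth a j : nat)]; pose b := tnth a i.
have ib j : (b <= tnth a j)%N.
  by rewrite /b /i; case: arg_minnP => // j' _ /(_ j)->.
pose u : d.-tuple 'I_m.+1 := [tuple inord (tnth a (lift i j) - b)%N | j < d].
have uE j : tnth u j = (tnth a (lift i j) - b)%N :> nat.
  by rewrite tnth_mktuple inordK // (leq_ltn_trans (leq_subr _ _)).
have sumE : (\sum_l tnth a l = d.+1 * b + \sum_l tnth u l)%N.
  rewrite (bigD1_ord i) //= (eq_bigr (fun l => tnth u l + b)%N) => [|l _].
    by rewrite big_split /= sum_nat_const card_ord -/b; lia.
  by rewrite uE subnK.
have sumR : (\sum_l tnth a l)%N%:R = (d%:R + 1) * b%:R + (\sum_l tnth u l)%N%:R :> R.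
  by rewrite sumE natrD natrM natr1.
exists b, i, u; split.
- apply: eq_from_tnth => l; rewrite tnth_mktuple.
  case: (unliftP i l) => [j|] -> //; apply: val_inj => /=.
  by rewrite uE subnK // inordK.
- have := aX i; rewrite -/b sumR.
  have : 0 <= (\sum_l tnth u l)%N%:R :> R by [].
  lra.
- rewrite inE; apply/forallP => j; have := aX (lift i j).
  have -> : tnth a (lift i j) = (tnth u j + b)%N :> nat by rewrite uE subnK.
  by rewrite sumR natrD; lra.
Qed.

Lemma card_corner_rec d (X : R) : (#|corner d.+1 X| <=
  \sum_(b < m.+1 | ((k + d%:R) * b%:R <= X)%R)
    d.+1 * #|corner d (X - (k + d%:R) * b%:R)%R|)%N.
Proof.
pose T := [set p : 'I_m.+1 * ('I_d.+1 * d.-tuple 'I_m.+1) |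
  ((k + d%:R) * p.1%:R <= X) && (p.2.2 \in corner d (X - (k + d%:R) * p.1%:R))].
have sub : corner d.+1 X \subset
    [set insert_above p.1 p.2.1 p.2.2 | p in T].
  apply/fintype.subsetP => a /corner_insert[b [i [u [-> bX uX]]]].
  by apply/imsetP; exists (b, (i, u)) => //; rewrite inE /= bX.
apply: leq_trans (subset_leq_card sub) (leq_trans (leq_imset_card _ _) _).
rewrite -sum1_card (eq_bigl (fun p : 'I_m.+1 * ('I_d.+1 * d.-tuple 'I_m.+1) =>
  ((k + d%:R) * p.1%:R <= X) && (p.2.2 \in corner d (X - (k + d%:R) * p.1%:R)))).
  rewrite -(pair_big_dep (fun b : 'I_m.+1 => (k + d%:R) * b%:R <= X)
    (fun b p => p.2 \in corner d (X - (k + d%:R) * b%:R)) (fun _ _ => 1%N)) /=.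
  apply: leq_sum => b _.
  rewrite -(pair_big_dep xpredT (fun _ u => u \in corner d (X - (k + d%:R) * b%:R))
    (fun _ _ => 1%N)) /=.
  by rewrite sum_nat_const card_ord sum1_card.
by move=> p; rewrite inE.
Qed.

Lemma bernoulli_pow d (y w : R) : 0 <= y -> 0 <= w ->
  y ^+ d.+1 + d.+1%:R * w * y ^+ d <= (y + w) ^+ d.+1.
Proof.
move=> y0 w0; elim: d => [|d IH]; first by rewrite !expr1 expr0; lra.
rewrite [leRHS]exprS; apply: le_trans (ler_wpM2l (addr_ge0 y0 w0) IH).
rewrite -[d.+2%:R]natr1 exprS [y ^+ d.+1]exprS -subr_ge0.
rewrite [X in 0 <= X](_ : _ = d.+1%:R * w ^+ 2 * y ^+ d); last by ring.
by rewrite !mulr_ge0 ?exprn_ge0.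
Qed.

(** The right side is the volume with [X] enlarged to absorb rounding. By induction
    [card_corner_rec] gives a sum over [b], which [bernoulli_pow] compares with a telescoping
    one. *)
Lemma card_corner d (X : R) : 0 <= X ->
  #|corner d X|%:R <=
    (X + \sum_(j < d) (k + j%:R)) ^+ d / \prod_(j < d) (k + j%:R).
Proof.
elim: d X => [|d IH] X X0.
  rewrite big_ord0 expr0 divr1 -[1]/(1%:R) ler_nat.
  by rewrite (leq_trans (max_card _)) // card_tuple.
rewrite !big_ord_recr /=; set c := \sum_(j < d) _; set P := \prod_(j < d) _.
have kj j : 0 < k + (j : nat)%:R by rewrite ltr_wpDr ?ler0n // (lt_le_trans ltr01).
have c0 : 0 <= c by apply: sumr_ge0 => j _; apply: ltW.
have P0 : 0 < P by apply: prodr_gt0.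
set w := k + d%:R; have w0 : 0 < w by apply: kj.
(* Clipping at 0 keeps [g] nonincreasing, so the indices with [w * b > X] contribute nonnegative
   differences. *)
pose g (b : nat) := Num.max (X + c + w - w * b%:R) 0 ^+ d.+1.
rewrite [P * w]mulrC invfM mulrCA ler_pdivlMl //.
apply: (@le_trans _ _ ((\sum_(b < m.+1) (g b - g b.+1)) / P)); last first.
  rewrite ler_wpM2r ?invr_ge0 ?(ltW P0) //.
  rewrite -(big_mkord xpredT (fun b => g b - g b.+1)).
  rewrite (@telescope_sumr_eq _ _ _ (fun b => - g b)) // => [|b _]; last first.
    by rewrite opprK addrC.
  have -> : g 0%N = (X + (c + w)) ^+ d.+1.
    have xcw : 0 <= X + c + w by exact: addr_ge0 (addr_ge0 X0 c0) (ltW w0).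
    by rewrite /g mulr0n mulr0 subr0 max_l // (addrA X c w).
  rewrite opprK; have : 0 <= g m.+1 by rewrite exprn_ge0 // le_max lexx orbT.
  lra.
apply: (@le_trans _ _ (w * (\sum_(b < m.+1 | (w * b%:R <= X)%R)
    d.+1 * #|corner d (X - w * b%:R)%R|)%N%:R)).
  by rewrite ler_pM2l // ler_nat card_corner_rec.
rewrite natr_sum mulr_sumr mulr_suml big_mkcond /=.
apply: ler_sum => b _; case: ifP => [bX|_]; last first.
  rewrite divr_ge0 ?(ltW P0) // subr_ge0 /g lerXn2r ?nnegrE ?le_max ?lexx ?orbT //.
  rewrite !ge_max lexx andbT lerD2l lerN2 ler_pM2l // ler_nat leqnSn /=.
  case: (leP 0 (X + c + w - w * b%:R)) => //= neg.
  apply: le_trans (ltW neg); rewrite lerD2l lerN2 ler_pM2l //.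
  by rewrite ler_nat.
have bX' : 0 <= X - w * b%:R by lra.
rewrite natrM; apply: (@le_trans _ _ (w * (d.+1%:R *
    ((X - w * b%:R + c) ^+ d / P)))).
  by rewrite ler_pM2l // ler_pM2l ?ltr0n // IH.
rewrite !mulrA ler_wpM2r ?invr_ge0 ?(ltW P0) //.
have y0 : 0 <= X - w * b%:R + c by rewrite addr_ge0.
rewrite /g !max_l -?natr1; [|lra|lra].
have := bernoulli_pow d y0 (ltW w0).
rewrite (_ : X + c + w - w * b%:R = X - w * b%:R + c + w); last by ring.
rewrite (_ : X + c + w - w * (b%:R + 1) = X - w * b%:R + c); last by ring.
by rewrite [w * _]mulrC; lra.
Qed.

End CountBound.

(** * The vanishing lemma *)

Section AffineSubstitution.
Variables (F : fieldType) (d : nat).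
Implicit Types (f g : {mpoly F[d]}) (M : 'M[F]_d) (b : 'rV[F]_d) (m : 'X_{1..d}).

Definition aform M b (i : 'I_d) : {mpoly F[d]} :=
  (b 0 i)%:MP + \sum_j M j i *: 'X_j.

(* The substitution [f (X *m M + b)], where [X] is the row of variables. *)
Definition asub M b f : {mpoly F[d]} := f \mPo [tuple aform M b i | i < d].

HB.instance Definition _ M b := GRing.Linear.copy (asub M b)
  (comp_mpoly [tuple aform M b i | i < d]).

Lemma asubX M b m : asub M b 'X_[m] = \prod_i aform M b i ^+ m i.
Proof. by rewrite /asub comp_mpolyX; apply: eq_bigr => i _; rewrite tnth_mktuple. Qed.

Lemma asubE M b f : asub M b f = \sum_(m <- msupp f) f@_m *: asub M b 'X_[m].
Proof. by rewrite {1}[f]mpolyE linear_sum; apply: eq_bigr => m _; rewrite linearZ. Qed.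

Lemma asub_comp M b M' b' f :
  asub M b (asub M' b' f) = asub (M *m M') (b *m M' + b') f.
Proof.
have asub_form i : asub M b (aform M' b' i) = aform (M *m M') (b *m M' + b') i.
  rewrite /asub /aform comp_mpolyD comp_mpolyC linear_sum /=.
  rewrite (eq_bigr (fun j => (b 0 j * M' j i)%:MP +
      \sum_l (M l j * M' j i) *: 'X_l)) => [|j _]; last first.
    rewrite comp_mpolyZ comp_mpolyXU -tnth_nth tnth_mktuple scalerDr scaler_sumr.
    rewrite -mul_mpolyC -mpolyCM [M' j i * _]mulrC; congr (_ + _).
    by apply: eq_bigr => l _; rewrite scalerA mulrC.
  have -> : (b *m M' + b') 0 i = b' 0 i + \sum_j b 0 j * M' j i.
    by rewrite !mxE addrC.
  rewrite big_split /= addrA mpolyCD raddf_sum /=; congr (_ + _).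
  rewrite exchange_big; apply: eq_bigr => l _.
  by rewrite mxE scaler_suml.
rewrite [asub M' b' f]asubE linear_sum [RHS]asubE; apply: eq_bigr => m _.
rewrite linearZ /= !asubX /asub rmorph_prod /=; congr (_ *: _).
by apply: eq_bigr => i _; rewrite rmorphXn /= -/(asub _ _ _) asub_form.
Qed.

Lemma asub_id f : asub 1%:M 0 f = f.
Proof.
rewrite /asub -[RHS]comp_mpoly_id; congr (_ \mPo _).
apply: eq_from_tnth => i; rewrite !tnth_mktuple /aform mxE mpolyC0 add0r.
rewrite (bigD1 i) //= mxE eqxx scale1r big1 ?addr0 // => j ji.
by rewrite mxE (negPf ji) scale0r.
Qed.

(** [lo] bounds the order of vanishing at the origin and [hi] the degree. Affine substitutions
    preserve only the latter, linear ones both. *)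
Definition between (lo hi : nat) f := forall m, f@_m != 0 -> (lo <= mdeg m <= hi)%N.

Lemma betweenW lo hi lo' hi' f : (lo' <= lo)%N -> (hi <= hi')%N ->
  between lo hi f -> between lo' hi' f.
Proof. by move=> ? ? fb m /fb /andP[? ?]; apply/andP; split; lia. Qed.

Lemma between0 lo hi : between lo hi 0.
Proof. by move=> m; rewrite mcoeff0 eqxx. Qed.

Lemma betweenD lo hi f g : between lo hi f -> between lo hi g -> between lo hi (f + g).
Proof.
move=> fb gb m; rewrite mcoeffD; have [/eqP ->|/fb //] := boolP (f@_m == 0).
by rewrite add0r => /gb.
Qed.

Lemma betweenZ lo hi c f : between lo hi f -> between lo hi (c *: f).
Proof. by move=> fb m; rewrite mcoeffZ mulf_eq0 negb_or => /andP[_ /fb]. Qed.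

Lemma betweenX m : between (mdeg m) (mdeg m) 'X_[m].
Proof.
by move=> m'; rewrite mcoeffX; have [<-|_] := eqVneq m m'; rewrite ?leqnn ?eqxx.
Qed.

Lemma between_sum lo hi (T : Type) (s : seq T) (G : T -> {mpoly F[d]}) :
  (forall t, between lo hi (G t)) -> between lo hi (\sum_(t <- s) G t).
Proof.
move=> Gb; elim: s => [|t s IH]; first by rewrite big_nil; apply: between0.
by rewrite big_cons; apply: betweenD.
Qed.

Lemma betweenM lo hi lo' hi' f g : between lo hi f -> between lo' hi' g ->
  between (lo + lo') (hi + hi') (f * g).
Proof.
move=> fb gb m; rewrite -mcoeff_msupp => /msuppM_le /allpairsP[[m1 m2] /= []].
rewrite !mcoeff_msupp => /fb /andP[? ?] /gb /andP[? ?] ->.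
by rewrite mdegD; apply/andP; split; lia.
Qed.

Lemma between_prod lo hi (c : 'I_d -> nat) (G : 'I_d -> {mpoly F[d]}) :
  (forall i, between lo hi (G i)) ->
  between (lo * \sum_i c i) (hi * \sum_i c i) (\prod_i G i ^+ c i).
Proof.
move=> Gb; have b1 : between 0 0 (1 : {mpoly F[d]}).
  by have := @betweenX (0%MM : 'X_{1..d}); rewrite mdeg0 mpolyX0.
elim: (index_enum _) => [|i s IH]; first by rewrite !big_nil !muln0.
rewrite !big_cons !mulnDr; apply: betweenM => //.
elim: (c i) => [|k IHk]; first by rewrite !muln0 expr0.
by rewrite !mulnS exprS; apply: betweenM.
Qed.

Lemma aform_between M b i : between 0 1 (aform M b i).
Proof.
apply: betweenD => [m|].
  by rewrite mcoeffC; have [->|_] := eqVneq m 0%MM; rewrite ?mdeg0 ?mulr0 ?eqxx.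
apply: between_sum => j; apply: betweenZ.
by apply: (@betweenW 1 1) => //; have := @betweenX U_(j)%MM; rewrite mdeg1.
Qed.

Lemma aform0_between M i : between 1 1 (aform M 0 i).
Proof.
rewrite /aform mxE mpolyC0 add0r; apply: between_sum => j; apply: betweenZ.
by have := @betweenX U_(j)%MM; rewrite mdeg1.
Qed.

Lemma asub_between hi M b f : between 0 hi f -> between 0 hi (asub M b f).
Proof.
move=> fb; rewrite asubE big_seq; elim/big_ind: _ => [||m]; first exact: between0.
  by move=> *; apply: betweenD.
rewrite mcoeff_msupp => /fb /andP[_ mh]; apply: betweenZ; rewrite asubX.
apply: (@betweenW (0 * mdeg m) (1 * mdeg m)); [by []|by rewrite mul1n|].
rewrite mdegE; apply: between_prod => i; exact: aform_between.
Qed.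

Lemma asub0_between lo hi M f : between lo hi f -> between lo hi (asub M 0 f).
Proof.
move=> fb; rewrite asubE big_seq; elim/big_ind: _ => [||m]; first exact: between0.
  by move=> *; apply: betweenD.
rewrite mcoeff_msupp => /fb /andP[lm mh]; apply: betweenZ; rewrite asubX.
apply: (@betweenW (1 * mdeg m) (1 * mdeg m)); [by rewrite mul1n|by rewrite mul1n|].
rewrite mdegE; apply: between_prod => i; exact: aform0_between.
Qed.

End AffineSubstitution.

(** * Multiplicities of zeros and restriction to a line *)

Section Roots.
Variable F : fieldType.
Implicit Types (h : {poly F}) (u : F).

Lemma dvdp_shift h u r : (forall t, (t < r)%N -> (h \Po ('X + u%:P))`_t = 0) ->
  ('X - u%:P) ^+ r %| h.
Proof.
move=> h0; set k := h \Po _ in h0.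
have kE : k = drop_poly r k * 'X^r.
  apply/polyP => t; rewrite coefMXn coef_drop_poly; case: ltnP => [/h0 //|rt].
  by rewrite subnK.
by rewrite -(comp_polyXaddC_K h u) -/k kE comp_polyM rmorphXn /= comp_polyX dvdp_mull.
Qed.

Lemma sum_roots_lt_size (I : eqType) (s : seq I) (u : I -> F) (r : I -> nat) h :
  uniq s -> {in s &, injective u} -> h != 0 ->
  (forall q, q \in s -> ('X - (u q)%:P) ^+ r q %| h) ->
  (\sum_(q <- s) r q < size h)%N.
Proof.
move=> us ui h0 hr.
have : \prod_(q <- s) ('X - (u q)%:P) ^+ r q %| h.
  elim: s us ui hr => [|q s IH] /=; first by rewrite big_nil dvd1p.
  move=> /andP[qs us] ui hr; rewrite big_cons Gauss_dvdp.
    rewrite hr ?mem_head // IH // => [x y xs ys|x xs].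
      by apply: ui; rewrite inE ?xs ?ys orbT.
    by apply: hr; rewrite inE xs orbT.
  rewrite big_seq; elim/big_ind: _ => [||x xs]; first exact: coprimep1.
    by move=> *; rewrite coprimepMr; apply/andP.
  apply: coprimep_expl; apply: coprimep_expr; rewrite coprimep_XsubC root_XsubC.
  apply: contra qs => /eqP uE; rewrite -(ui x q) ?inE ?eqxx ?xs ?orbT //.
move=> /(dvdp_leq h0); apply: leq_trans.
rewrite size_prod_seq => [|q _]; last by rewrite expf_neq0 // polyXsubC_eq0.
have -> : (\sum_(q <- s) size (('X - (u q)%:P) ^+ r q) =
    \sum_(q <- s) (r q + 1))%N.
  by apply: eq_bigr => q _; rewrite size_exp_XsubC addn1.
by rewrite big_split /= sum1_size; lia.
Qed.

End Roots.

Section LineRestriction.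
Variables (F : fieldType) (d : nat).
Implicit Types (f : {mpoly F[d]}) (m g : 'X_{1..d}) (i : 'I_d).

Definition upd i g (t : nat) : 'X_{1..d} := [multinom if j == i then t else g j | j < d].

Definition agree i m g := [forall j, (j != i) ==> (m j == g j)].

Lemma upd_inj i m g s t : (upd i m s == upd i g t) = agree i m g && (s == t).
Proof.
apply/eqP/andP => [/mnmP E|[/forallP mg /eqP ->]].
  split; last by have := E i; rewrite !mnmE eqxx => ->.
  apply/forallP => j; apply/implyP => ji.
  by have := E j; rewrite !mnmE (negPf ji) => ->.
apply/mnmP => j; rewrite !mnmE; case: eqP => // /eqP ji.
by have /implyP/(_ ji)/eqP := mg j.
Qed.

Lemma updE i m : upd i m (m i) = m.
Proof. by apply/mnmP => j; rewrite mnmE; case: eqP => // ->. Qed.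

Lemma mdeg_upd i g t : (mdeg (upd i g t) + g i = t + mdeg g)%N.
Proof.
rewrite !mdegE (bigD1 i) //= [in RHS](bigD1 i) //= mnmE eqxx.
rewrite (eq_bigr (fun j => g j)) => [|j ji]; last by rewrite mnmE (negPf ji).
lia.
Qed.

(* The coefficient of [\prod_(j != i) 'X_j ^+ g j] in [f], a polynomial in ['X_i]. *)
Definition cut i g f : {poly F} := \poly_(t < msize f) f@_(upd i g t).

Lemma coef_cut i g f t : (cut i g f)`_t = f@_(upd i g t).
Proof.
rewrite coef_poly; case: ltnP => // ft; apply/esym/eqP.
rewrite mcoeff_eq0; apply: msize_mdeg_ge; apply: leq_trans ft _.
by rewrite mdegE (bigD1 i) //= mnmE eqxx leq_addr.
Qed.

Lemma cut_is_linear i g : linear (cut i g).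
Proof.
by move=> c f f'; apply/polyP => t; rewrite coefD coefZ !coef_cut mcoeffD mcoeffZ.
Qed.

HB.instance Definition _ i g := GRing.isLinear.Build F {mpoly F[d]} {poly F} _
  (cut i g) (cut_is_linear i g).

Lemma cutX i g m : cut i g 'X_[m] = (agree i m g)%:R *: 'X^(m i).
Proof.
apply/polyP => t; rewrite coef_cut mcoeffX coefZ coefXn -{1}(updE i m) upd_inj.
by rewrite [t == _]eq_sym; case: agree => /=; rewrite ?mul1r ?mul0r.
Qed.

(** A shift along the [i]-th axis changes only ['X_i], so it commutes with fixing the other
    exponents; on monomials both sides are binomial expansions. *)
Lemma cut_shift i g u f :
  cut i g (asub 1%:M (u *: delta_mx 0 i) f) = cut i g f \Po ('X + u%:P).
Proof.
have aformE j : aform 1%:M (u *: delta_mx 0 i) j =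
    'X_j + (if j == i then u else 0)%:MP :> {mpoly F[d]}.
  rewrite /aform !mxE eqxx /= (bigD1 j) //= mxE eqxx scale1r.
  rewrite (big1 _ (fun l => l != j)) => [|l lj]; last by rewrite mxE (negPf lj) scale0r.
  by rewrite addr0 addrC; case: (j == i); rewrite ?mulr1 ?mulr0.
rewrite asubE [in RHS](mpolyE f) !linear_sum /=; apply: eq_bigr => m _.
rewrite !linearZ /= cutX asubX linearZ /= rmorphXn /= comp_polyX.
congr (_ *: _).
have -> : \prod_j aform 1%:M (u *: delta_mx 0 i) j ^+ m j =
    \sum_(k < (m i).+1) (u ^+ k *+ 'C(m i, k)) *: 'X_[upd i m (m i - k)].
  rewrite (bigD1 i) //= aformE eqxx exprDn mulr_suml; apply: eq_bigr => k _.
  rewrite [X in _ = _ *: X]mpolyXE_id [in RHS](bigD1 i) //= mnmE eqxx.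
  rewrite (eq_bigr (fun j => 'X_j ^+ m j)) => [|j ji]; last first.
    by rewrite aformE (negPf ji) mpolyC0 addr0.
  rewrite [in RHS](eq_bigr (fun j => 'X_j ^+ m j)) => [|j ji]; last first.
    by rewrite mnmE (negPf ji).
  rewrite -(rmorphXn (@mpolyC d F)) /= mulrnAl [_ * (u ^+ k)%:MP]mulrC mul_mpolyC.
  by rewrite -scalerAl scalerMnl.
rewrite exprDn linear_sum scaler_sumr /=; apply: eq_bigr => k _.
rewrite linearZ /= cutX mnmE eqxx (_ : agree i (upd i m _) g = agree i m g).
  rewrite scalerA [_ * (agree _ _ _)%:R]mulrC -scalerA; congr (_ *: _).
  by rewrite -mul_polyC polyCMn polyC_exp mulrC mulrnAr.
apply: eq_forallb => j; case: eqP => //= /eqP ji.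
by rewrite mnmE (negPf ji).
Qed.

End LineRestriction.

Section Region.
Variables (d : nat) (P Lt : finType) (ell : P -> 'I_d -> Lt).

Definition meets (q : P) (l : Lt) : bool := [exists j, ell q j == l].

(* The exponents [g] whose coefficient at [p] is prescribed. [D] are handicaps:
   the coefficient [g] at [p] has time [|g| + D p], so when all earlier ones vanish
   the polynomial has order at least [|g| + D p - D q] (truncated) at [q]. *)
Definition region (n : nat) (W : {set P}) (D : P -> nat) (p : P) : {set d.-tuple 'I_n.+1} :=
  [set g : d.-tuple 'I_n.+1 | [forall i,
    (\sum_(q in W | (q != p) && meets q (ell p i)) (tnth g i + D p - D q)
       + \sum_l tnth g l <= n)%N]].

End Region.

Section Vanishing.
Variables (F : fieldType) (d : nat) (P Lt : finType) (ell : P -> 'I_d -> Lt).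
Variables (pt : P -> 'rV[F]_d) (V : P -> 'M[F]_d).
Hypothesis V_unit : forall p, V p \in unitmx.
Hypothesis pt_inj : injective pt.
Hypothesis collinear : forall p q i, meets ell q (ell p i) ->
  exists u, pt q = pt p + u *: row i (V p).
Variable n : nat.

Definition mon (g : d.-tuple 'I_n.+1) : 'X_{1..d} := [multinom (tnth g i : nat) | i < d].

Lemma mdeg_mon g : mdeg (mon g) = (\sum_l tnth g l)%N.
Proof. by rewrite mdegE; apply: eq_bigr => l _; rewrite mnmE. Qed.

Lemma mon_surj m : (mdeg m <= n)%N -> exists g, m = mon g.
Proof.
move=> mn; exists [tuple inord (m i) | i < d]; apply/mnmP => i.
rewrite mnmE tnth_mktuple inordK // ltnS; apply: leq_trans mn.
by rewrite mdegE (bigD1 i) //= leq_addr.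
Qed.

Lemma mon_inj : injective mon.
Proof.
move=> g g' /mnmP E; apply: eq_from_tnth => i; apply: val_inj.
by have := E i; rewrite !mnmE.
Qed.

(** The expansion at [pt p] in coordinates along the rows of [V p]. Coefficients, unlike
    derivatives, behave well in every characteristic. *)
Definition taylor p (f : {mpoly F[d]}) := asub (V p) (pt p) f.

Lemma vanishing (W : {set P}) (D : P -> nat) (p0 : P) (f : {mpoly F[d]}) :
  p0 \in W -> between 0 n f ->
  (forall p g, p \in W -> g \in region ell n W D p -> (taylor p f)@_(mon g) = 0) ->
  f = 0.
Proof.
move=> p0W fn f0; apply/eqP/negPn/negP => fN0.
have tn p : between 0 n (taylor p f) by apply: asub_between.
pose alive T := [exists p in W, exists g, ((taylor p f)@_(mon g) != 0) &&
  (\sum_l tnth g l + D p == T)%N].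
have exT : exists T, alive T.
  have : taylor p0 f != 0.
    apply: contra fN0 => /eqP t0.
    rewrite -[f]asub_id -(mulVmx (V_unit p0)).
    rewrite (_ : 0 = - (pt p0 *m invmx (V p0)) *m V p0 + pt p0); last first.
      by rewrite mulNmx mulmxKV // addNr.
    by rewrite -asub_comp -/(taylor p0 f) t0 linear0.
  rewrite -mleadc_eq0 => nz; have /andP[_ /mon_surj[g gE]] := tn _ _ nz.
  exists (\sum_l tnth g l + D p0)%N; apply/existsP; exists p0; rewrite p0W /=.
  by apply/existsP; exists g; rewrite -gE nz /=.
(* A surviving coefficient of least time [T] is taken; hence at each [q] in [W] all terms of degree
   below [T - D q] vanish. *)
case: (ex_minnP exT) => T /existsP[p /andP[pW /existsP[g /andP[gN0 /eqP gT]]]] Tmin.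
have early q : q \in W -> between (T - D q) n (taylor q f).
  move=> qW m nz; have /andP[_ mn] := tn _ _ nz; rewrite mn andbT.
  have [g' gE] := mon_surj mn; rewrite leq_subLR addnC gE mdeg_mon.
  apply: Tmin; apply/existsP; exists q; rewrite qW /=.
  by apply/existsP; exists g'; rewrite -gE nz /=.
have gn : (\sum_l tnth g l <= n)%N.
  by have /andP[_] := tn _ _ gN0; rewrite mdeg_mon.
have : g \notin region ell n W D p by apply: contra gN0 => gr; rewrite f0.
rewrite inE negb_forall => /existsP[i]; rewrite -ltnNge => viol.
have gi : (tnth g i <= \sum_l tnth g l)%N by rewrite (bigD1 i) //= leq_addr.
pose h := cut i (mon g) (taylor p f).
have hN0 : h != 0.
  apply: contra gN0 => /eqP h0; have := coef_cut i (mon g) (taylor p f) (mon g i).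
  by rewrite updE -/h h0 coef0 => <-.
(* The list contains [p] itself, where the multiplicity [r p] is [tnth g i]. *)
pose s := [seq q <- enum W | meets ell q (ell p i)].
have [u uE] : {u : P -> F | forall q, q \in s -> pt q = pt p + u q *: row i (V p)}.
  have ex q : exists u, q \in s -> pt q = pt p + u *: row i (V p).
    have [qs|] := boolP (q \in s); last by exists 0.
    by move: qs; rewrite mem_filter => /andP[/collinear[u uE] _]; exists u.
  by have [u uE] := choice ex; exists u.
have sW q : q \in s -> q \in W by rewrite mem_filter mem_enum => /andP[].
pose r q := (tnth g i + D p - D q)%N.
have := @sum_roots_lt_size F _ s u r h _ _ hN0 _; rewrite ltnNge => /(_ _ _ _)/negP; apply.
- by rewrite filter_uniq // enum_uniq.
- by move=> q q' qs q's uq; apply: pt_inj; rewrite uE // [RHS]uE // uq.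
(* Shifting [h] moves the base point to [q] in the basis [V p]. The change from the basis [V q] is
   linear, so the order given by [early] survives. *)
- move=> q qs; apply: dvdp_shift => t tr.
  rewrite -cut_shift coef_cut /taylor asub_comp mul1mx.
  rewrite -scalemxAl -rowE addrC -uE //.
  rewrite (_ : V p = (V p *m invmx (V q)) *m V q); last by rewrite mulmxKV.
  rewrite -[pt q]add0r -(mul0mx _ (V q)) -asub_comp.
  apply/eqP/negPn/negP => /(asub0_between (early q (sW q qs)))/andP[low _].
  have := mdeg_upd i (mon g) t; rewrite mdeg_mon mnmE.
  move: low tr gi; rewrite /r -gT; move: (\sum_l _)%N (mdeg _) (nat_of_ord _).
  by move: (D p) (D q); clear; lia.
(* The fixed exponents already use degree [|g| - g_i] out of [n]. *)
have size_h : (size h <= n - \sum_l tnth g l + tnth g i + 1)%N.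
  apply/leq_sizeP => t nt; rewrite coef_cut; apply/eqP/negPn/negP => /tn/andP[_ hi].
  have := mdeg_upd i (mon g) t; rewrite mdeg_mon mnmE.
  move: hi nt gn; move: (\sum_l _)%N (mdeg _) (nat_of_ord _); clear; lia.
apply: leq_trans size_h _; rewrite big_filter big_enum_cond /=.
rewrite (bigD1 p) /=; last by rewrite pW; apply/existsP; exists i.
move: viol; rewrite (eq_bigl (fun q => ((q \in W) && meets ell q (ell p i)) && (q != p))).
  rewrite [r p]addnK; move: gn gi.
  rewrite -/(r _) (eq_bigr r) //; move: (\sum_(q | _) r q)%N (\sum_l _)%N (nat_of_ord _).
  by clear; lia.
by move=> q; rewrite [(q != p) && _]andbC andbA.
Qed.

Lemma card_region_ge (W : {set P}) (D : P -> nat) (p0 : P) : p0 \in W ->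
  ('C(d + n, d) <= \sum_(p in W) #|region ell n W D p|)%N.
Proof.
move=> p0W; rewrite -card_partial_ord_partitions; set M := [set t | _].
pose E := [set e : P * d.-tuple 'I_n.+1 | (e.1 \in W) && (e.2 \in region ell n W D e.1)].
have -> : (\sum_(p in W) #|region ell n W D p|)%N = #|E|.
  rewrite -[RHS]sum1_card (eq_bigl (fun e : P * d.-tuple 'I_n.+1 =>
    (e.1 \in W) && (e.2 \in region ell n W D e.1))) => [|e]; last by rewrite inE.
  rewrite -(pair_big_dep (mem W) (fun p g => g \in region ell n W D p) (fun _ _ => 1%N)).
  by apply: eq_bigr => p _; rewrite sum1_card.
rewrite leqNgt; apply/negP => EM.
(* Rows are the monomials of degree at most [n], columns the prescribed coefficients. With fewer
   columns than rows, a kernel vector is a nonzero polynomial contradicting [vanishing]. *)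
pose A : 'M[F]_(#|M|, #|E|) := \matrix_(a, e)
  (taylor (enum_val e).1 'X_[mon (enum_val a)])@_(mon (enum_val e).2).
have kerN0 : kermx A != 0.
  rewrite -mxrank_eq0 mxrank_ker subn_eq0 -ltnNge.
  exact: leq_ltn_trans (rank_leq_col A) EM.
have [c cA cN0] : exists2 c : 'rV_#|M|, c *m A = 0 & c != 0.
  have /rowV0Pn[c /sub_kermxP cA cN0] := kerN0; by exists c.
pose f : {mpoly F[d]} := \sum_a c 0 a *: 'X_[mon (enum_val a)].
have f0 : f = 0.
  apply: (@vanishing W D p0 f p0W) => [|p g pW gr].
    apply: between_sum => a; apply: betweenZ => m; rewrite mcoeffX.
    have [<- _|_] := eqVneq (mon (enum_val a)) m; last by rewrite eqxx.
    rewrite leq0n mdeg_mon /=; have := enum_valP a; rewrite inE big_tuple.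
    by [].
  have eE : (p, g) \in E by rewrite inE pW gr.
  have := congr1 (fun B : 'rV_#|E| => B 0 (enum_rank_in eE (p, g))) cA.
  rewrite !mxE => <-; rewrite /taylor /f (linear_sum (asub (V p) (pt p))) raddf_sum /=.
  by apply: eq_bigr => a _; rewrite linearZ /= mcoeffZ mxE enum_rankK_in.
case/negP: cN0; apply/eqP/rowP => a; rewrite mxE.
have := congr1 (mcoeff (mon (enum_val a))) f0.
rewrite mcoeff0 raddf_sum /= (bigD1 a) //= mcoeffZ mcoeffX eqxx mulr1.
rewrite big1 ?addr0 // => b ba; rewrite mcoeffZ mcoeffX.
by rewrite (inj_eq mon_inj) (inj_eq enum_val_inj) (negPf ba) mulr0.
Qed.

End Vanishing.

(** * Choosing the handicaps *)

Section Equalization.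
Variables (d : nat) (P Lt : finType) (ell : P -> 'I_d.+1 -> Lt) (n : nat).
Implicit Types (W : {set P}) (D : P -> nat) (p q : P).

Local Notation N D p := #|region ell n [set: P] D p|.

Lemma sub_region_handicap D D' p : D' p = D p -> (forall q, (D q <= D' q)%N) ->
  region ell n [set: P] D p \subset region ell n [set: P] D' p.
Proof.
move=> Dp DD'; apply/fintype.subsetP => g; rewrite !inE => /forallP gr.
apply/forallP => i; apply: leq_trans (gr i); rewrite leq_add2r Dp.
by apply: leq_sum => q _; rewrite leq_sub2l.
Qed.

(** Exponents are at most [n], so a joint outside [W] contributes a truncated difference equal to
    0. *)
Lemma sub_region_localize W D p : (forall q, q \notin W -> (D p + n <= D q)%N) ->
  region ell n W D p \subset region ell n [set: P] D p.
Proof.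
move=> gap; apply/fintype.subsetP => g; rewrite !inE => /forallP gr.
apply/forallP => i; apply: leq_trans (gr i); rewrite leq_add2r.
rewrite (bigID (mem W)) /= [X in (_ + X)%N]big1 ?addn0 => [|q /andP[_ /gap Dq]].
  rewrite leq_eqVlt; apply/orP; left; apply/eqP; apply: eq_bigl => q.
  by rewrite inE andbC.
by apply/eqP; rewrite subn_eq0; apply: leq_trans Dq; rewrite addnC leq_add2l -ltnS.
Qed.

Lemma card_zero_coord (i : 'I_d.+1) :
  (#|[set g : d.+1.-tuple 'I_n.+1 | tnth g i == ord0]| <= n.+1 ^ d)%N.
Proof.
pose del (g : d.+1.-tuple 'I_n.+1) : d.-tuple 'I_n.+1 := [tuple tnth g (lift i j) | j < d].
rewrite -(card_in_imset (f := del)) => [|g g'].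
  by apply: leq_trans (max_card _) _; rewrite card_tuple card_ord.
rewrite !inE => /eqP gi /eqP g'i E; apply: eq_from_tnth => j.
case: (unliftP i j) => [j'|] ->; last by rewrite gi g'i.
by have := congr1 (fun t => tnth t j') E; rewrite !tnth_mktuple.
Qed.

(** Lowering all exponents by one compensates for the raised handicap. Only the [g] with a zero
    coordinate are lost. *)
Lemma region_drop D D' p : D' p = (D p).+1 -> (forall q, q != p -> D' q = D q) ->
  (N D p <= N D' p + d.+1 * n.+1 ^ d)%N.
Proof.
move=> Dp Dq; pose Z := [set g : d.+1.-tuple 'I_n.+1 | [exists i, tnth g i == ord0]].
pose dec (g : d.+1.-tuple 'I_n.+1) : d.+1.-tuple 'I_n.+1 :=
  [tuple inord (tnth g i).-1 | i < d.+1].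
have decE g i : tnth (dec g) i = (tnth g i).-1 :> nat.
  by rewrite tnth_mktuple inordK // (leq_ltn_trans (leq_pred _)).
have pos g i : g \notin Z -> (0 < tnth g i)%N.
  by rewrite inE negb_exists => /forallP/(_ i); rewrite lt0n.
rewrite -(cardsID Z) addnC leq_add //.
  rewrite -(card_in_imset (f := dec)) => [|g g']; last first.
    rewrite !finset.in_setD => /andP[gZ _] /andP[g'Z _] E; apply: eq_from_tnth => i.
    apply: val_inj; rewrite /= -(prednK (pos _ i gZ)) -(prednK (pos _ i g'Z)).
    by rewrite -!decE E.
  apply/subset_leq_card/fintype.subsetP => g' /imsetP[g gD ->] {g'}.
  move: gD; rewrite finset.in_setD => /andP[gZ]; rewrite !inE => /forallP gr.
  apply/forallP => i; apply: leq_trans (gr i); apply: leq_add.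
    apply: leq_sum => q /and3P[_ qp _]; rewrite decE Dp (Dq q qp).
    by rewrite addnS -addSn prednK // pos.
  by apply: leq_sum => l _; rewrite decE leq_pred.
apply: leq_trans (subset_leq_card (finset.subsetIr _ _)) _.
have -> : Z = \bigcup_i [set g : d.+1.-tuple 'I_n.+1 | tnth g i == ord0].
  apply/setP => g; rewrite inE; apply/existsP/bigcupP => [[i gi]|[i _]].
    by exists i; rewrite ?inE.
  by rewrite inE => gi; exists i.
have : (\sum_(i < d.+1) #|[set g : d.+1.-tuple 'I_n.+1 | tnth g i == ord0]|
    <= d.+1 * n.+1 ^ d)%N.
  rewrite -[X in (_ <= X * _)%N](card_ord d.+1) -sum_nat_const.
  by apply: leq_sum => i _; apply: card_zero_coord.
apply: leq_trans; elim/big_ind2: _ => [|A a B b Aa Bb|i _] //.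
  by rewrite finset.cards0.
by apply: leq_trans (leq_card_setU _ _) (leq_add Aa Bb).
Qed.

(** Pigeonhole: if each interval [(m n, (m + 1) n]] with [m < #|P|] contained a handicap, then with
    [p0] there would be more than [#|P|] joints. *)
Lemma handicap_gap D p0 : D p0 = 0%N ->
  exists m, (m < #|P|)%N /\ forall q, (m * n < D q)%N -> (m.+1 * n < D q)%N.
Proof.
move=> Dp0; apply: contrapT => noW.
have grow m : (m <= #|P|)%N -> (m < #|[set q | (D q <= m * n)%N]|)%N.
  elim: m => [|m IH] mP.
    by rewrite card_gt0; apply/set0Pn; exists p0; rewrite inE Dp0.
  apply: leq_ltn_trans (IH (ltnW mP)) _; apply: proper_card.
  apply/properP; split.
    by apply/fintype.subsetP => q; rewrite !inE mulSn; lia.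
  have : exists q, ~~ ((m * n < D q)%N ==> (m.+1 * n < D q)%N).
    apply: contrapT => none; apply: noW; exists m; split => // q.
    by apply/implyP/negPn/negP => bad; apply: none; exists q.
  by case=> q; rewrite negb_imply -leqNgt => /andP[a b]; exists q; rewrite !inE // -ltnNge.
have := grow #|P| (leqnn _); rewrite ltnNge => /negP; apply; exact: max_card.
Qed.

(* Raise, one by one, the handicap of a joint of [W] carrying at least the average
   number of conditions, where [W] is a set of joints with small handicaps which the
   joints outside [W] do not affect. A joint which has been raised keeps, up to the
   loss of a single step, an average number of conditions. *)
Lemma exists_handicaps (B : nat) :
  (forall W D p0, p0 \in W -> (B <= \sum_(p in W) #|region ell n W D p|)%N) ->
  exists D : P -> nat, forall p, (B <= #|P| * (N D p + d.+1 * n.+1 ^ d))%N.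
Proof.
move=> avg; set delta := (d.+1 * n.+1 ^ d)%N.
have [P0|P_gt0] := posnP #|P|.
  by exists (fun=> 0%N) => p; have := fintype0 p; rewrite P0.
(* Joints of [W] have handicap at most [#|P| * n], so a raised one still fits in ['I_K.+1]. *)
pose K := (#|P| * n).+1.
pose nD (D : {ffun P -> 'I_K.+1}) (q : P) : nat := D q.
pose good D p := (B <= #|P| * (N D p + delta))%N.
pose Q (D : {ffun P -> 'I_K.+1}) := [forall p, (D p == ord0) || good (nD D) p].
have Q0 : Q [ffun=> ord0] by apply/forallP => p; rewrite ffunE eqxx.
(* The total handicap is maximal under the invariant [Q]; a bad joint would allow one more raise
   that preserves [Q]. *)
case: (arg_maxnP (fun D : {ffun P -> 'I_K.+1} => \sum_q nD D q)%N Q0) => D /forallP QD Dmax.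
exists (nD D) => p0; apply: contrapT => /negP bad.
have Dp0 : nD D p0 = 0%N by have := QD p0; rewrite /good (negPf bad) orbF /nD => /eqP ->.
have [m [mP gap]] := handicap_gap Dp0.
pose W := [set q | (nD D q <= m * n)%N].
have p0W : p0 \in W by rewrite inE Dp0.
have [p pW pB] : exists2 p, p \in W & (B <= #|P| * #|region ell n W (nD D) p|)%N.
  apply: contrapT => none.
  have small p : p \in W -> (#|P| * #|region ell n W (nD D) p| <= B.-1)%N.
    move=> pW; have [|] := leqP B (#|P| * #|region ell n W (nD D) p|).
      by move=> pB; case: none; exists p.
    by case: (B).
  have B_gt0 : (0 < B)%N.
    by case: (posnP B) => // B0; case: none; exists p0; rewrite ?B0.
  have := avg W (nD D) p0 p0W; rewrite leqNgt => /negP; apply.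
  rewrite -(ltn_pmul2l P_gt0) big_distrr /=.
  apply: (@leq_ltn_trans (\sum_(p in W) B.-1)); first exact: leq_sum.
  rewrite sum_nat_const.
  apply: (@leq_ltn_trans (#|P| * B.-1)); last by rewrite ltn_pmul2l // prednK.
  by rewrite leq_mul2r max_card orbT.
have pN : (B <= #|P| * N (nD D) p)%N.
  apply: leq_trans pB _; rewrite leq_mul2l; apply/orP; right.
  apply/subset_leq_card/sub_region_localize => q; rewrite inE -ltnNge => /gap.
  by move: pW; rewrite inE mulSn; lia.
have Dp : (nD D p < K)%N.
  move: pW; rewrite inE ltnS => /leq_trans; apply.
  by rewrite leq_mul2r (ltnW mP) orbT.
pose D' : {ffun P -> 'I_K.+1} := [ffun q => if q == p then inord (D q).+1 else D q].
have D'p : nD D' p = (nD D p).+1 by rewrite /nD ffunE eqxx inordK.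
have D'q q : q != p -> nD D' q = nD D q by move=> qp; rewrite /nD ffunE (negPf qp).
have QD' : Q D'.
  apply/forallP => q; have [->|qp] := eqVneq q p.
    apply/orP; right; apply: leq_trans pN _; rewrite leq_mul2l; apply/orP; right.
    exact: region_drop.
  have := QD q; rewrite ffunE (negPf qp); case: eqP => //= _ qB.
  apply: leq_trans qB _; rewrite leq_mul2l leq_add2r; apply/orP; right.
  apply/subset_leq_card/sub_region_handicap; first exact: D'q.
  by move=> q'; have [->|/D'q ->] := eqVneq q' p; rewrite ?D'p.
have : (\sum_q nD D' q <= \sum_q nD D q)%N by exact: Dmax.
rewrite leqNgt => /negP; apply.
rewrite (bigD1 p) //= [X in (_ < X)%N](bigD1 p) //= D'p addSn ltnS leq_add2l.
by apply: leq_sum => q /D'q ->.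
Qed.

End Equalization.

(** * From the regions to the number of lines *)

Section Asymptotics.
Variable R : archiRealFieldType.

Lemma pow_add_le d (y w : R) : 0 <= y -> 0 <= w ->
  (y + w) ^+ d.+1 <= y ^+ d.+1 + d.+1%:R * w * (y + w) ^+ d.
Proof.
move=> y0 w0; elim: d => [|d IH]; first by rewrite !expr1 expr0; lra.
have yw0 : 0 <= y + w by lra.
rewrite [leLHS]exprS; apply: le_trans (ler_wpM2l yw0 IH) _.
rewrite -[d.+2%:R]natr1 [(y + w) ^+ d.+1]exprS [y ^+ d.+2]exprS -subr_ge0.
rewrite [X in 0 <= X](_ : _ = w * ((y + w) ^+ d.+1 - y ^+ d.+1)); last first.
  by rewrite [(y + w) ^+ d.+1]exprS; ring.
by rewrite mulr_ge0 // subr_ge0 lerXn2r ?nnegrE //; lra.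
Qed.

(** Leading coefficients are compared at one explicit large [n]; [M] collects the lower-order terms,
    using [n + C <= 2 n] and [n + 1 <= 2 n]. *)
Lemma le_leading_coef d (c c' b C : R) : 0 <= c' -> 0 <= b -> 0 <= C ->
  (forall n : nat, c * n%:R ^+ d.+1 <= c' * (n%:R + C) ^+ d.+1 + b * (n%:R + 1) ^+ d) ->
  c <= c'.
Proof.
move=> c'0 b0 C0 le_n; rewrite leNgt; apply/negP => cc'.
pose M := (c' * (d.+1%:R * C) + b) * 2 ^+ d.
have M0 : 0 <= M by rewrite mulr_ge0 ?exprn_ge0 // addr_ge0 // !mulr_ge0.
have e0 : 0 < c - c' by lra.
have Me0 : 0 <= M / (c - c') by rewrite divr_ge0 // ltW.
pose n := Num.bound (1 + C + M / (c - c')).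
have nP : 1 + C + M / (c - c') < n%:R.
  by apply: archi_boundP; rewrite !addr_ge0.
have n0 : 0 < n%:R :> R by lra.
have pow2 : 2 ^+ d * n%:R ^+ d = (2 * n%:R) ^+ d :> R by rewrite exprMn.
have nC : (n%:R + C) ^+ d <= 2 ^+ d * n%:R ^+ d :> R.
  by rewrite pow2 lerXn2r ?nnegrE //; lra.
have n1 : (n%:R + 1) ^+ d <= 2 ^+ d * n%:R ^+ d :> R.
  by rewrite pow2 lerXn2r ?nnegrE //; lra.
have : (c - c') * n%:R ^+ d.+1 <= M * n%:R ^+ d.
  rewrite mulrBl lerBlDl; apply: le_trans (le_n n) _.
  have h1 := ler_wpM2l c'0 (pow_add_le d (ltW n0) C0).
  have h2 := ler_wpM2l (mulr_ge0 c'0 (mulr_ge0 (ler0n R d.+1) C0)) nC.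
  have h3 := ler_wpM2l b0 n1.
  apply: le_trans (lerD h1 h3) _; rewrite mulrDr -addrA lerD2l.
  rewrite /M [X in _ <= X](_ : _ = c' * (d.+1%:R * C) * (2 ^+ d * n%:R ^+ d) +
    b * (2 ^+ d * n%:R ^+ d)); last by ring.
  by rewrite lerD2r [leLHS]mulrA; exact: h2.
rewrite exprS mulrA ler_pM2r ?exprn_gt0 // -ler_pdivlMl // mulrC.
by move=> ?; lra.
Qed.

Lemma bin_ge_pow n d : (n%:R ^+ d / d`!%:R <= 'C(d + n, d)%:R :> R).
Proof.
rewrite ler_pdivrMr ?ltr0n ?fact_gt0 // -natrM bin_ffact -natrX ler_nat.
by elim: d => [|d IH] //; rewrite addSn ffactSS expnS leq_mul // leqW // leq_addl.
Qed.

End Asymptotics.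

(** * Double counting of incidences *)

Section Incidences.
Variables (d : nat) (P Lt : finType) (ell : P -> 'I_d.+1 -> Lt).
Hypothesis ell_inj : forall p, injective (ell p).

(** Injectivity of [ell p] makes each pair of a joint and a line through it occur for exactly one
    index [j]. *)
Lemma sum_incidence (R : nmodType) (G : P -> Lt -> R) :
  \sum_(x : P * 'I_d.+1) G x.1 (ell x.1 x.2) =
  \sum_l \sum_(p | meets ell p l) G p l.
Proof.
rewrite -(pair_bigA _ (fun p j => G p (ell p j))) /=.
rewrite [RHS](exchange_big_dep xpredT) //=; apply: eq_bigr => p _.
rewrite (eq_bigl (mem [set ell p j | j in 'I_d.+1])) => [|l].
  by rewrite big_imset //= => j j' _ _; apply: ell_inj.
by apply/existsP/imsetP => [[j /eqP <-]|[j _ ->]]; exists j.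
Qed.

Definition mult (l : Lt) := #|[pred p | meets ell p l]|.

Lemma sum_mult (R : nmodType) (c : R) l : \sum_(p | meets ell p l) c = c *+ mult l.
Proof. by rewrite sumr_const; congr (_ *+ _); apply: eq_card. Qed.

Lemma meets_ell p i : meets ell p (ell p i).
Proof. by apply/existsP; exists i. Qed.

Lemma mult_gt0 p i : (0 < mult (ell p i))%N.
Proof. by apply/card_gt0P; exists p; rewrite inE meets_ell. Qed.

Lemma sum_inv_mult (R : numFieldType) :
  \sum_(x : P * 'I_d.+1) (mult (ell x.1 x.2))%:R^-1 <= #|Lt|%:R :> R.
Proof.
rewrite (sum_incidence (fun _ l => (mult l)%:R^-1)).
rewrite -sum1_card natr_sum; apply: ler_sum => l _.
rewrite sum_mult -[leLHS]mulr_natl.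
by have [->|m0] := posnP (mult l); rewrite ?mul0r ?ler01 // divff // pnatr_eq0 -lt0n.
Qed.

(** On a line with [k] joints, both terms sum to [k] times the total handicap of the line. *)
Lemma sum_handicaps (R : zmodType) (D : P -> R) :
  \sum_(x : P * 'I_d.+1) (\sum_(q | meets ell q (ell x.1 x.2)) D q -
    D x.1 *+ mult (ell x.1 x.2)) = 0.
Proof.
rewrite (sum_incidence (fun p l => \sum_(q | meets ell q l) D q - D p *+ mult l)).
rewrite big1 // => l _; by rewrite sumrB sum_mult sumrMnl subrr.
Qed.

(** Truncation is dropped, and the [i]-th exponent within [|g|] serves as the missing term [q = p],
    whence the full multiplicity. *)
Lemma region_linear (R : realDomainType) n (D : P -> nat) p (g : d.+1.-tuple 'I_n.+1) i :
  g \in region ell n [set: P] D p ->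
  (mult (ell p i))%:R * (tnth g i)%:R + \sum_(l | l != i) (tnth g l)%:R <=
  n%:R + (\sum_(q | meets ell q (ell p i)) (D q)%:R -
     (D p)%:R *+ mult (ell p i)) :> R.
Proof.
rewrite inE => /forallP/(_ i); rewrite -(ler_nat R) => gr.
set T := \sum_(l | l != i) _; set S := \sum_(q | meets ell q _) _.
pose U := \sum_(q | meets ell q (ell p i)) ((tnth g i)%:R + (D p)%:R - (D q)%:R) : R.
have UE : U = (tnth g i)%:R *+ mult (ell p i) + (D p)%:R *+ mult (ell p i) - S.
  by rewrite /U sumrB big_split /= !sum_mult.
have -> : (mult (ell p i))%:R * (tnth g i)%:R = U + S - (D p)%:R *+ mult (ell p i).
  by rewrite UE subrK addrK mulr_natl.
suff : U + T <= n%:R by lra.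
apply: le_trans gr.
have sumE : (\sum_l tnth g l)%N%:R = (tnth g i)%:R + T :> R.
  by rewrite (bigD1 i) //= natrD natr_sum.
have UE' : U = (tnth g i)%:R + \sum_(q | meets ell q (ell p i) && (q != p))
    ((tnth g i)%:R + (D p)%:R - (D q)%:R).
  by rewrite /U (bigD1 p) ?meets_ell //= addrK.
rewrite natrD sumE UE' addrAC [leRHS]addrC lerD2l natr_sum.
rewrite [leRHS](eq_bigl (fun q => meets ell q (ell p i) && (q != p))) => [|q].
  apply: ler_sum => q _; rewrite lerBlDr -!natrD ler_nat.
  by move: (nat_of_ord _) (D p) (D q) => a b c; clear; lia.
by rewrite inE /= andbC.
Qed.

End Incidences.

Section IncidenceBound.
Variables (R : realType) (d : nat) (P Lt : finType) (ell : P -> 'I_d.+1 -> Lt).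
Hypothesis ell_inj : forall p, injective (ell p).
Hypothesis P_gt0 : (0 < #|P|)%N.

Local Notation I := (P * 'I_d.+1)%type.

Let I_gt0 : (0 < #|{: I}|)%N.
Proof. by rewrite card_prod card_ord muln_gt0 P_gt0. Qed.

Definition rot (i : 'I_d.+1) (x : I) : I := (x.1, i + x.2).

Lemma rot_inj i : injective (rot i).
Proof.
move=> [p c] [q e] E; have pq := congr1 (fun x : I => x.1) E.
have ce := congr1 (fun x : I => x.2) E; rewrite /= in pq ce.
by rewrite pq (addrI _ ce).
Qed.

Lemma sum_rot (G : I -> R) i : \sum_x G (rot i x) = \sum_x G x.
Proof. by rewrite [RHS](reindex_inj (@rot_inj i)). Qed.

Lemma gmean_rot (G : I -> R) i : gmean (fun x => G (rot i x)) = gmean G.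
Proof. by rewrite /gmean [X in _ = nroot _ X](reindex_inj (@rot_inj i)). Qed.

Definition incid (x : I) : R := (mult ell (ell x.1 x.2))%:R.

Definition incid_mean : R := gmean incid.

Lemma incid_gt0 x : 0 < incid x.
Proof. by rewrite ltr0n mult_gt0. Qed.

Lemma incid_mean_ge1 : 1 <= incid_mean.
Proof.
rewrite -(gmean_cst I_gt0 (@ler01 R)); apply: le_gmean => // x.
by rewrite ler01 ler1n mult_gt0.
Qed.

Lemma incid_mean_le : incid_mean <= #|P|%:R.
Proof.
rewrite -(gmean_cst I_gt0 (ler0n R #|P|)); apply: le_gmean => // x.
by rewrite ler0n ler_nat max_card.
Qed.

Variables (n : nat) (D : P -> nat).

Definition tshift (c : 'I_d.+1) (g : d.+1.-tuple 'I_n.+1) : d.+1.-tuple 'I_n.+1 :=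
  [tuple tnth g (i + c) | i < d.+1].

Lemma tshift_inj c : injective (tshift c).
Proof.
move=> g g' E; apply: eq_from_tnth => i.
by have := congr1 (fun t => tnth t (i - c)) E; rewrite !tnth_mktuple subrK.
Qed.

(* All cyclic shifts are used, so that averaging over [x] makes the constraints
   on the coordinates symmetric. *)
Definition shifted_region (x : I) : {set d.+1.-tuple 'I_n.+1} :=
  [set tshift x.2 g | g in region ell n [set: P] D x.1].

(** Passing to upper corners adds the number of joints on the line plus [d], at most [#|P| + d]. *)
Lemma shifted_region_sum i (x : I) u : u \in shifted_region x ->
  \sum_l (if l == i then incid (rot i x) else 1) * (tnth u l).+1%:R <=
  n%:R + (\sum_(q | meets ell q (ell x.1 (rot i x).2)) (D q)%:R -
    (D x.1)%:R *+ mult ell (ell x.1 (rot i x).2)) + (#|P| + d)%:R :> R.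
Proof.
case/imsetP => g /(region_linear R (i + x.2)) gr ->.
rewrite (bigD1 i) //= eqxx tnth_mktuple.
rewrite (eq_bigr (fun l => (tnth g (l + x.2))%:R + 1)) => [|l li]; last first.
  by rewrite (negPf li) mul1r tnth_mktuple natr1.
rewrite big_split /= sumr_const cardC1 card_ord /=.
rewrite (_ : \sum_(l | l != i) (tnth g (l + x.2))%:R =
    \sum_(l | l != i + x.2) (tnth g l)%:R); last first.
  rewrite [RHS](reindex_inj (addIr x.2)) /=; apply: eq_bigl => l.
  by rewrite (inj_eq (addIr _)).
have kP : incid (rot i x) <= #|P|%:R by rewrite ler_nat max_card.
rewrite -natr1 mulrDr mulr1 natrD /incid /= in kP *.
move: gr kP; lra.
Qed.

(** Superadditivity moves the geometric mean outside the sum over coordinates, and the arithmetic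
    mean over all [x] then cancels the handicaps. Rotations permute the index set, so every [i] sees
    the same mean [incid_mean]. *)
Lemma shifted_corner :
  gmean_set R shifted_region \subset corner incid_mean n d.+1 (n%:R + (#|P| + d)%:R).
Proof.
apply/fintype.subsetP => a; rewrite !inE.
move=> /existsP[t /andP[/forallP tr /forallP ta]]; apply/forallP => i.
pose X l : R := gmean (fun x => (tnth (t x) l).+1%:R).
have k1 := incid_mean_ge1.
pose G l (x : I) : R := (if l == i then incid (rot i x) else 1) * (tnth (t x) l).+1%:R.
have G_ge0 l x : 0 <= G l x.
  by rewrite /G mulr_ge0 //; case: ifP => // _; rewrite ltW ?incid_gt0.
have GX l : gmean (G l) = (if l == i then incid_mean else 1) * X l.
  rewrite /G /X; case: ifP => _; last first.
    by rewrite mul1r; congr gmean; apply/funext => x; rewrite mul1r.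
  have incid_ge0 x : 0 <= incid (rot i x) by rewrite ltW ?incid_gt0.
  by rewrite (gmeanM I_gt0 incid_ge0) // (gmean_rot incid).
apply: (@le_trans _ _ (\sum_l gmean (G l))).
  rewrite natr_sum (bigD1 i) //= [leRHS](bigD1 i) //= GX eqxx addrA.
  have -> : (incid_mean - 1) * (tnth a i)%:R + (tnth a i)%:R = incid_mean * (tnth a i)%:R.
    by ring.
  apply: lerD; first by rewrite ler_wpM2l ?(le_trans ler01) // ltW // ta.
  by apply: ler_sum => l li; rewrite GX (negPf li) mul1r ltW // ta.
apply: le_trans (gmean_sum I_gt0 G_ge0) _.
apply: le_trans (gmean_le_mean I_gt0 _) _ => [x|]; first by apply: sumr_ge0.
rewrite ler_pdivrMr ?ltr0n //.
pose H (x : I) : R := \sum_(q | meets ell q (ell x.1 x.2)) (D q)%:R -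
    (D x.1)%:R *+ mult ell (ell x.1 x.2).
apply: (@le_trans _ _ (\sum_(x : I) (n%:R + (#|P| + d)%:R + H (rot i x)))).
  apply: ler_sum => x _; rewrite addrAC.
  exact: shifted_region_sum (tr x).
rewrite big_split /= sum_rot (sum_handicaps ell_inj (fun p => (D p)%:R)) addr0.
by rewrite sumr_const mulr_natr.
Qed.

End IncidenceBound.

Section IncidenceTheorem.
Variables (R : realType) (d : nat) (P Lt : finType) (ell : P -> 'I_d.+1 -> Lt).
Hypothesis ell_inj : forall p, injective (ell p).
Hypothesis P_gt0 : (0 < #|P|)%N.
Hypothesis region_ge : forall n (W : {set P}) D p0, p0 \in W ->
  ('C(d.+1 + n, d.+1) <= \sum_(p in W) #|region ell n W D p|)%N.

Local Notation kb := (incid_mean R ell).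

Lemma prod_incid_mean_gt0 : 0 < \prod_(j < d.+1) (kb + j%:R).
Proof.
apply: prodr_gt0 => j _; rewrite ltr_wpDr //.
exact: lt_le_trans ltr01 (incid_mean_ge1 R ell P_gt0).
Qed.

Lemma prod_incid_mean_le :
  \prod_(j < d.+1) (kb + j%:R) <= (d.+1)`!%:R * #|P|%:R.
Proof.
set K := \prod_(j < d.+1) _; have K_gt0 : 0 < K := prod_incid_mean_gt0.
have J_gt0 : 0 < #|P|%:R :> R by rewrite ltr0n.
have f_gt0 : 0 < (d.+1)`!%:R :> R by rewrite ltr0n fact_gt0.
rewrite -lef_pV2 ?posrE ?mulr_gt0 //.
pose C : R := (#|P| + d)%:R + \sum_(j < d.+1) (#|P|%:R + j%:R).
have C_ge0 : 0 <= C by rewrite addr_ge0 ?sumr_ge0 // => j _; rewrite addr_ge0.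
(* The inverses are the leading coefficients, in [n], of a lower and an upper bound for
   [tau + delta], where [tau] is the size guaranteed for every region. *)
apply: (@le_leading_coef _ d _ _ d.+1%:R C) => [|||n] //.
  by rewrite invr_ge0 ltW.
have [D goodD] := exists_handicaps (@region_ge n).
pose N p : R := #|region ell n [set: P] D p|%:R.
pose delta : R := d.+1%:R * n.+1%:R ^+ d.
pose tau : R := 'C(d.+1 + n, d.+1)%:R / #|P|%:R - delta.
have tauN p : tau <= N p.
  rewrite /tau lerBlDr ler_pdivrMr // mulrC.
  by have := goodD p; rewrite -(ler_nat R) natrM natrD natrM natrX.
have tau_le : tau <= (n%:R + C) ^+ d.+1 / K.
  have [tau0|tau_gt0] := leP tau 0.
    apply: le_trans tau0 (divr_ge0 _ (ltW K_gt0)).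
    exact: exprn_ge0 (addr_ge0 (ler0n R n) C_ge0).
  have I_gt0 : (0 < #|{: P * 'I_d.+1}|)%N by rewrite card_prod card_ord muln_gt0 P_gt0.
  pose gm : R := gmean (fun x => #|shifted_region ell n D x|%:R : R).
  apply: (@le_trans _ _ gm).
    rewrite -[tau](gmean_cst I_gt0 (ltW tau_gt0)); apply: le_gmean => // x.
    by rewrite ltW //= card_imset ?tauN //; apply: tshift_inj.
  apply: le_trans (gmean_card_le R I_gt0 _) _.
  have := subset_leq_card (shifted_corner R ell_inj P_gt0 n D).
  rewrite -(ler_nat R) => /le_trans; apply.
  apply: le_trans (card_corner _ (incid_mean_ge1 R ell P_gt0) _ _) _.
    by rewrite addr_ge0.
  have kb0 : 0 <= kb by apply: le_trans (incid_mean_ge1 R ell P_gt0).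
  rewrite ler_wpM2r ?invr_ge0 ?(ltW K_gt0) //; apply: lerXn2r; rewrite ?nnegrE.
  - by apply: addr_ge0; rewrite ?addr_ge0 ?sumr_ge0 // => j _; rewrite addr_ge0.
  - exact: addr_ge0 (ler0n R n) C_ge0.
  - rewrite /C addrA lerD2l; apply: ler_sum => j _.
    by rewrite lerD2r incid_mean_le.
rewrite [K^-1 * _]mulrC natr1 -/delta -lerBlDr; apply: le_trans tau_le.
rewrite /tau lerD2r invfM mulrC mulrA ler_wpM2r ?invr_ge0 ?(ltW J_gt0) //.
exact: bin_ge_pow.
Qed.

Lemma incidence_bound (x : R) : d.+1%:R <= x ->
  #|P|%:R = gbinom x d.+1 -> gbinom x d <= #|Lt|%:R.
Proof.
move=> xd cardP.
have f_gt0 : 0 < (d.+1)`!%:R :> R by rewrite ltr0n fact_gt0.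
have d1 : d.+1%:R = d%:R + 1 :> R by rewrite natr1.
have xd0 : 0 < x - d%:R by lra.
have kb1 := incid_mean_ge1 R ell P_gt0.
have kbx : kb <= x - d%:R.
  rewrite leNgt; apply/negP => xk.
  have := prod_incid_mean_le; rewrite cardP /gbinom mulrC mulfVK ?gt_eqF //.
  rewrite leNgt => /negP; apply.
  (* Reversal pairs [kb + j] with the smaller factor [x - d + j]. *)
  rewrite (reindex_inj rev_ord_inj) /=; apply: ltr_prod.
    by apply/hasP; exists ord0; rewrite ?mem_index_enum.
  move=> j _; have jd : (j <= d)%N by rewrite -ltnS.
  have j0 : 0 <= (j : nat)%:R :> R by [].
  have -> : (d.+1 - j.+1)%N%:R = d%:R - j%:R :> R by rewrite subSS natrB.
  by apply/andP; split; lra.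
have inv_le := sum_inv_mult ell_inj R.
have I_gt0 : (0 < #|{: P * 'I_d.+1}|)%N by rewrite card_prod card_ord muln_gt0 P_gt0.
have inv_ge0 (y : P * 'I_d.+1) : 0 <= (incid R ell y)^-1.
  by rewrite invr_ge0 ltW // incid_gt0.
have kbV : gmean (fun y => (incid R ell y)^-1) = kb^-1.
  apply: (@mulfI _ kb); first by rewrite gt_eqF // (lt_le_trans ltr01).
  rewrite mulfV ?gt_eqF ?(lt_le_trans ltr01) // /incid_mean.
  rewrite -gmeanM //.
  rewrite -[RHS](gmean_cst I_gt0 (@ler01 R)); congr gmean; apply/funext => y.
  by rewrite mulfV // gt_eqF // incid_gt0.
(* The arithmetic-geometric mean inequality for the inverse multiplicities gives
   [#|Lt| >= (d + 1) #|P| / kb]. *)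
have := gmean_le_mean I_gt0 inv_ge0; rewrite kbV ler_pdivlMr ?ltr0n //.
move=> le1; apply: le_trans inv_le; apply: le_trans le1.
rewrite card_prod card_ord natrM cardP.
apply: (@le_trans _ _ ((x - d%:R)^-1 * (gbinom x d.+1 * d.+1%:R))).
  rewrite /gbinom big_ord_recr /= factS natrM le_eqVlt; apply/orP; left; apply/eqP.
  have d0 : 1 + d%:R != 0 :> R by rewrite addrC -d1 pnatr_eq0.
  have f0 : d`!%:R != 0 :> R by rewrite pnatr_eq0 -lt0n fact_gt0.
  by field; rewrite f0 d0 gt_eqF.
rewrite ler_wpM2r //; first by rewrite -cardP mulr_ge0.
by rewrite lef_pV2 ?posrE // (lt_le_trans ltr01).
Qed.

End IncidenceTheorem.

(** * Directions of lines, and the theorem on joints *)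

Section JointsGeometry.
Variables (F : fieldType) (d : nat).
Implicit Types (p q v w : 'rV[F]_d) (l : set 'rV[F]_d).

Lemma direction_points l v p q : is_direction l v -> l p -> l q ->
  exists u, q = p + u *: v.
Proof.
case=> _ [p0 ->] [s ->] [t ->]; exists (t - s).
by rewrite -addrA -scalerDl [s + _]addrC subrK.
Qed.

Lemma direction_parallel l v w : is_direction l v -> is_direction l w ->
  exists u, v = u *: w.
Proof.
move=> lv lw; have [_ [p0 lE]] := lv.
have l0 : l p0 by rewrite lE; exists 0; rewrite scale0r addr0.
have l1 : l (p0 + v) by rewrite lE; exists 1; rewrite scale1r.
by have [u /addrI ->] := direction_points lw l0 l1; exists u.
Qed.

Lemma free_row_free (v : 'I_d -> 'rV[F]_d) :
  free [tuple v i | i < d] -> row_free (\matrix_i v i).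
Proof.
move=> /freeP fv; apply: inj_row_free => c cv; apply/rowP => i; rewrite mxE.
apply: (fv (fun i => c 0 i)); rewrite -[RHS]cv mulmx_sum_row.
by apply: eq_bigr => j _; rewrite rowK -tnth_nth tnth_mktuple.
Qed.

Lemma row_free_parallel (A : 'M[F]_d) i j u :
  row_free A -> row i A = u *: row j A -> i = j.
Proof.
move=> fA ij; apply/eqP/negPn/negP => neq.
have : delta_mx 0 i = u *: delta_mx 0 j :> 'rV[F]_d.
  by apply: (row_free_inj fA); rewrite -scalemxAl -!rowE.
move=> /rowP/(_ i); rewrite !mxE !eqxx (negPf neq) mulr0 => /eqP.
by rewrite oner_eq0.
Qed.

End JointsGeometry.

Theorem theorem1p2 (F : fieldType) (d : nat) (d_gt0 : (0 < d)%N)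
    (J : {fset 'rV[F]_d}) (L : {fset set 'rV[F]_d})
    (JL : joints_configuration J L)
    (R : realType) (x : R) (x_ge_d : d%:R <= x)
    (cardJ : (#|` J|)%:R = gbinom x d) :
  gbinom x (d - 1) <= (#|` L|)%:R.
Proof.
case: d d_gt0 => // d _ in J L JL x_ge_d cardJ *.
have {JL} [_ jointJ] := JL.
(* Each joint gets [d] lines and directions, the latter forming the rows of an invertible matrix. *)
have [l /choice[v lvP]] := choice (fun p : J => jointJ (val p) (fsvalP p)).
have lL p i : l p i \in L by have [/(_ i)[]] := lvP p.
have lp p i : l p i (val p) by have [/(_ i)[]] := lvP p.
have lv p i : is_direction (l p i) (v p i) by have [/(_ i)[]] := lvP p.
pose ell (p : J) i : L := [` lL p i].
pose V p : 'M[F]_d.+1 := \matrix_i v p i.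
have V_free p : row_free (V p) by apply: free_row_free; have [] := lvP p.
have V_unit p : V p \in unitmx by rewrite -row_free_unit.
have ell_inj p : injective (ell p).
  move=> i j /(congr1 val) /= lij.
  have lj : is_direction (l p i) (v p j) by rewrite lij.
  have [u uE] := direction_parallel (lv p i) lj.
  by apply: (row_free_parallel (u := u) (V_free p)); rewrite !rowK.
have collinear (p q : J) i : meets ell q (ell p i) ->
    exists u, val q = val p + u *: row i (V p).
  case/existsP => j /eqP/(congr1 val) /= lqp; rewrite rowK.
  by apply: direction_points (lv p i) (lp p i) _; rewrite -lqp.
(* Every factor of [gbinom x d] is positive because [x >= d]. *)
have J_gt0 : (0 < #|{: J}|)%N.
  rewrite -cardfE -(ltr_nat R) cardJ divr_gt0 ?ltr0n ?fact_gt0 //.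
  apply: prodr_gt0 => i _; rewrite subr_gt0 (lt_le_trans _ x_ge_d) // ltr_nat.
  exact: ltn_ord.
rewrite subn1 /= cardfE; rewrite cardfE in cardJ.
apply: (incidence_bound ell_inj J_gt0) => // n W D p0.
exact: (card_region_ge V_unit val_inj collinear).
Qed.
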